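(* For every integer $n\geq 5$ the group $S_n\times S_n$ is a strongly real Beauville group.
   Context: $S_n$ denotes the symmetric group of degree $n$. Let $G$ be a finite group. For $x,y\in G$ let $\Sigma(x,y):=\bigcup_{i=1}^{|G|}\bigcup_{g\in G}\{(x^i)^g,(y^i)^g,((xy)^i)^g\}$, where $a^g$ denotes the conjugate of $a$ by $g$. A Beauville structure (of unmixed type) for $G$ is a pair of generating pairs $\{\{x_1,y_1\},\{x_2,y_2\}\}$ with $x_i,y_i\in G$, such that $\langle x_1,y_1\rangle=\langle x_2,y_2\rangle=G$ and $\Sigma(x_1,y_1)\cap\Sigma(x_2,y_2)=\{e\}$, where $e$ is the identity element of $G$. A group having a Beauville structure is called a Beauville group. A Beauville group $G$ is strongly real if it has a Beauville structure $\{\{x_1,y_1\},\{x_2,y_2\}\}$ for which there exist an automorphism $\phi\in\mathrm{Aut}(G)$ and elements $g_1,g_2\in G$ such that $g_i\phi(x_i)g_i^{-1}=x_i^{-1}$ and $g_i\phi(y_i)g_i^{-1}=y_i^{-1}$ for $i=1,2$. *)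

(* Defs.v *)
From mathcomp Require Import all_boot all_fingroup.
Set Implicit Arguments.
Unset Strict Implicit.
Unset Printing Implicit Defensive.
Local Open Scope group_scope.

(* When b is a group element, a ^ b is the conjugate b^-1 * a * b. *)

Definition Sigma (gT : finGroupType) (G : {group gT}) (x y : gT) : {set gT} :=
  \bigcup_(1 <= i < #|G|.+1) \bigcup_(g in G)
    [set (x ^+ i) ^ g; (y ^+ i) ^ g; ((x * y) ^+ i) ^ g].

(* Both generation hypotheses force x1, y1, x2, y2 to lie in G. *)
Definition beauville_structure (gT : finGroupType) (G : {group gT})
    (x1 y1 x2 y2 : gT) : Prop :=
  [/\ <<[set x1; y1]>> = G, <<[set x2; y2]>> = G
    & Sigma G x1 y1 :&: Sigma G x2 y2 = [set 1]].

Definition strongly_real_beauville (gT : finGroupType) (G : {group gT}) : Prop :=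
  exists x1 y1 x2 y2 : gT,
    beauville_structure G x1 y1 x2 y2 /\
    exists (phi : {perm gT}) (g1 g2 : gT),
      [/\ phi \in Aut G, g1 \in G, g2 \in G,
          g1 * phi x1 * g1^-1 = x1^-1 /\ g1 * phi y1 * g1^-1 = y1^-1
        & g2 * phi x2 * g2^-1 = x2^-1 /\ g2 * phi y2 * g2^-1 = y2^-1].

(* Main.v *)
Require Import Defs.
From mathcomp Require Import all_boot all_fingroup.
From mathcomp Require Import all_solvable zify.

(* Write C_k for the cycle (0 1 ... k-1) in S_n, and put sigma = C_n,
   rho = C_(n-1) and tau = (n-2 n-1), so that tau sigma = rho. The first
   structure is x1 = (tau, sigma), y1 = (sigma, rho^-1), x1 y1 = (rho, tau).
   For the second, let k be the odd one among n-2 and n-3, let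
   alpha = C_k (k k+1), and let b be a product of two disjoint transpositions
   with <alpha, b> = S_n; take x2 = (alpha, b) and y2 = (b, alpha). The two
   components of x2 y2 are conjugate.
   Disjointness: nontrivial powers of tau, sigma, rho move 2, n, n-1 points,
   even powers of alpha move 0 or k points, and b moves 4. Powers of x1, y1 or
   x1 y1 with both components nontrivial move different numbers of points in
   the two components.
   Generation: a subgroup of S_n x S_n projecting onto both factors and meeting
   each of them in a nontrivial even permutation contains A_n x A_n, because A_n
   is simple; signs then decide.
   Reality: alpha and rho are inverted by reflections that commute with b and
   tau respectively, so inner automorphisms suffice. *)

Set Implicit Arguments.
Unset Strict Implicit.
Unset Printing Implicit Defensive.
Local Open Scope group_scope.

(** * Powers in products, parity of powers, elements of [Sigma] *)

Lemma fst_expg (gT1 gT2 : finGroupType) (u : gT1 * gT2) i : (u ^+ i).1 = u.1 ^+ i.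
Proof. by elim: i => // i IH; rewrite !expgS -IH. Qed.

Lemma snd_expg (gT1 gT2 : finGroupType) (u : gT1 * gT2) i : (u ^+ i).2 = u.2 ^+ i.
Proof. by elim: i => // i IH; rewrite !expgS -IH. Qed.

Lemma odd_permX (T : finType) (s : {perm T}) i : odd_perm (s ^+ i) = odd i && odd_perm s.
Proof.
elim: i => [|i IH]; first by rewrite expg0 odd_perm1.
by rewrite expgS odd_permM IH /=; case: (odd_perm s); case: (odd i).
Qed.

Section Sigma.
Variables (gT : finGroupType) (G : {group gT}).
Implicit Types x y w : gT.

Lemma Sigma_conj x y w : w \in Sigma G x y -> exists i g,
  [\/ w = (x ^+ i) ^ g, w = (y ^+ i) ^ g | w = ((x * y) ^+ i) ^ g].
Proof.
rewrite /Sigma; elim/big_ind: _ => [|A B IHA IHB|i _]; first by rewrite inE.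
  by rewrite inE => /orP [/IHA|/IHB].
case/bigcupP => g _; rewrite !inE -orbA => h; exists i, g.
by case/or3P: h => /eqP ->; [constructor 1|constructor 2|constructor 3].
Qed.

Lemma Sigma1 x y : x \in G -> 1 \in Sigma G x y.
Proof.
(* The last exponent, [#|G|], contributes the identity. *)
move=> xG; rewrite /Sigma big_nat_recr ?cardG_gt0 //= inE; apply/orP; right.
by apply/bigcupP; exists 1; rewrite // !inE expg_cardG // conj1g eqxx.
Qed.

End Sigma.

(** * The number of moved points *)

Section Moved.
Variable T : finType.
Implicit Types s g : {perm T}.

(** A conjugacy invariant coarser than cycle type: all nontrivial powers of one cycle share the same
    value, which makes disjointness a matter of arithmetic. *)
Definition moved s := #|[set x | s x != x]|.

Lemma movedJ s g : moved (s ^ g) = moved s.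
Proof.
rewrite /moved -(card_imset [set x | s x != x] (@perm_inj _ g)).
congr #|pred_of_set _|; apply/setP => x; rewrite -(permKV g x) (mem_imset _ _ (@perm_inj _ g)).
by rewrite !inE permJ (inj_eq perm_inj).
Qed.

Lemma movedV s : moved s^-1 = moved s.
Proof.
apply: eq_card => x; rewrite !inE; congr negb.
by rewrite -(inj_eq (@perm_inj _ s)) permKV eq_sym.
Qed.

Lemma moved1 : moved 1 = 0.
Proof. by apply/eqP; rewrite cards_eq0; apply/eqP/setP => x; rewrite !inE perm1 eqxx. Qed.

Lemma moved_eq0 s : moved s = 0 -> s = 1.
Proof.
move/eqP; rewrite cards_eq0 => /eqP/setP s1; apply/permP => x; rewrite perm1.
by apply/eqP; move: (s1 x); rewrite !inE => /negbFE.
Qed.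

Lemma moved_tperm x y : x != y -> moved (tperm x y) = 2.
Proof.
move=> nxy; suff -> : moved (tperm x y) = #|[set x; y]| by rewrite cards2 nxy.
congr #|pred_of_set _|; apply/setP => z; rewrite !inE.
case: tpermP => [->|->|]; first by rewrite eqxx eq_sym.
  by rewrite eqxx orbT.
by do 2!move/eqP/negPf ->; rewrite eqxx.
Qed.

Lemma moved_tperm2 x y z t : uniq [:: x; y; z; t] ->
  moved (tperm x y * tperm z t) = 4.
Proof.
move=> u; suff -> : moved (tperm x y * tperm z t) = #|[:: x; y; z; t]|.
  by rewrite (card_uniqP u).
move: u; rewrite /= !inE !negb_or => /and4P[/and3P[xy xz xt] /andP[yz yt] zt _].
apply: eq_card => w; rewrite !inE permM; case: (tpermP x y w) => [->|->|].
- by rewrite eqxx tpermD 1?eq_sym // eq_sym xy.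
- by rewrite eqxx orbT tpermD 1?eq_sym // eq_sym xy.
do 2!move/eqP/negPf ->; rewrite /=.
case: tpermP => [->|->|]; first by rewrite eqxx eq_sym.
  by rewrite eqxx orbT.
by do 2!move/eqP/negPf ->; rewrite eqxx.
Qed.

End Moved.

(** * Cycles on an initial segment and the reflections inverting them *)

Section Cycle.
Variables (n k : nat).
Hypothesis kn : k <= n.

Lemma cycle_subproof (x : 'I_n) :
  (if x.+1 < k then x.+1 else if x < k then 0 else x) < n.
Proof. by case: x => x /= xn; do ?case: ifP => ?; lia. Qed.

Lemma cycle_inj : injective (fun x => Ordinal (cycle_subproof x)).
Proof.
move=> [x xn] [y yn] /(congr1 val) /= e; apply: val_inj => /=.
by move: e; do ?case: ifP => ?; lia.
Qed.

Definition cyc : 'S_n := perm cycle_inj.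

Lemma flip_subproof (x : 'I_n) : (if x.+1 < k then k - x.+2 else x) < n.
Proof. by case: x => x /= xn; case: ifP => ?; lia. Qed.

Lemma flip_inj : injective (fun x => Ordinal (flip_subproof x)).
Proof.
move=> [x xn] [y yn] /(congr1 val) /= e; apply: val_inj => /=.
by move: e; do ?case: ifP => ?; lia.
Qed.

(** On points below [k] this is [x -> k - 2 - x] modulo [k]. Among the reflections inverting the
    cycle, it is the one fixing [k - 1]; hence it commutes with the transposition of [k - 1] and
    [k]. *)
Definition flip : 'S_n := perm flip_inj.

Lemma cycE x :
  cyc x = (if x.+1 < k then x.+1 else if x < k then 0 else x) :> nat.
Proof. by rewrite permE. Qed.

Lemma flipE x : flip x = (if x.+1 < k then k - x.+2 else x) :> nat.
Proof. by rewrite permE. Qed.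

Lemma flipV : flip^-1 = flip.
Proof.
apply/eqP; rewrite eq_invg_mul; apply/eqP/permP => x; apply: val_inj => /=.
rewrite permM perm1; have := flipE x; set y := flip x; have := flipE y.
by do ?case: ifP => ?; lia.
Qed.

Lemma flip_cyc : cyc ^ flip = cyc^-1.
Proof.
apply/esym/eqP; rewrite eq_invg_mul conjgE flipV; apply/eqP/permP => x.
apply: val_inj => /=; rewrite !permM perm1.
have := cycE x; set y := cyc x; have := flipE y; set z := flip y.
have := cycE z; set t := cyc z; have := flipE t.
by have := ltn_ord x; do ?case: ifP => ?; lia.
Qed.

Lemma cycXE i x : (cyc ^+ i) x = (if x < k then (x + i) %% k else x) :> nat.
Proof.
elim: i => [|i IH]; first by rewrite expg0 perm1 addn0; case: ltnP => // /modn_small.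
rewrite expgSr permM cycE IH; case: (ltnP x k) => xk; last by do ?case: ifP => ?; lia.
have k0 : 0 < k by lia.
rewrite addnS modnS; have := ltn_pmod (x + i) k0; case dv: (k %| (x + i).+1) => mk.
  have : (x + i).+1 %% k = 0 by apply/eqP; exact: dv.
  rewrite -addn1 -modnDml; case: (ltnP ((x + i) %% k).+1 k) => h; last by rewrite mk.
  by rewrite modn_small; lia.
case: ifP => // h; have e : ((x + i) %% k).+1 = k by lia.
by move: dv; rewrite /dvdn -addn1 -modnDml addn1 e modnn.
Qed.

Lemma moved_cycX i : moved (cyc ^+ i) = if k %| i then 0 else k.
Proof.
case: ifPn => ki.
  apply/eqP; rewrite cards_eq0; apply/eqP/setP => x; rewrite !inE; apply/negbTE.
  rewrite negbK -val_eqE /= cycXE; case: ltnP => // xk.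
  by case/dvdnP: ki => q ->; rewrite addnC modnMDl modn_small.
(* A rotation by a non-multiple of [k] moves exactly the points below [k], counted here as a copy of
   ['I_k]. *)
have -> : moved (cyc ^+ i) = #|[set widen_ord kn x | x in [set: 'I_k]]|.
  congr #|pred_of_set _|; apply/setP => x; rewrite !inE -val_eqE /= cycXE.
  case: ltnP => xk; last first.
    rewrite eqxx; apply/esym/negbTE/imsetP => -[y _ e].
    by move: xk; rewrite e /= leqNgt ltn_ord.
  have -> : x \in [set widen_ord kn x0 | x0 in [set: 'I_k]].
    by apply/imsetP; exists (Ordinal xk); rewrite ?inE //; apply: val_inj.
  rewrite -{2}(modn_small xk) -{2}[x : nat]addn0 eqn_modDl mod0n.
  exact: ki.
rewrite card_imset ?cardsT ?card_ord //.
by move=> x y /(congr1 val) /= e; apply: val_inj.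
Qed.

Lemma cycXk : cyc ^+ k = 1.
Proof. by apply: moved_eq0; rewrite moved_cycX dvdnn. Qed.

Lemma cyc_trans (x y : 'I_n) : x < k -> y < k -> exists i, (cyc ^+ i) x = y.
Proof.
move=> xk yk; exists (y + k - x); apply: val_inj => /=; rewrite cycXE xk.
by rewrite subnKC ?modnDr ?modn_small //; lia.
Qed.

(** For odd [k], the cycle has the parity of its [k]-th power, which is 1. *)
Lemma cyc_even : odd k -> odd_perm cyc = false.
Proof.
move=> ko; have := odd_permX cyc k.
by rewrite cycXk odd_perm1 ko.
Qed.

(** Powers of the cycle fix [z] and carry [x] to any point below [k], so conjugation by them yields
    the other transpositions. *)
Lemma mem_tperm_cyc (H : {group 'S_n}) (x y z : 'I_n) :
    cyc \in H -> tperm x z \in H -> x < k -> k <= z -> y < k ->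
  tperm y z \in H.
Proof.
move=> cH tH xk kz yk; have [i e] := cyc_trans xk yk.
have ez : (cyc ^+ i) z = z by apply: val_inj; rewrite /= cycXE ltnNge kz.
by rewrite -e -ez -tpermJ groupJ ?groupX.
Qed.

End Cycle.

(** * Generation criteria for S_n and S_n x S_n *)

Lemma gen_Sn n (H : {group 'S_n}) (z : 'I_n) :
  (forall y, tperm y z \in H) -> H = [set: 'S_n]%G.
Proof.
move=> h; apply/val_inj/eqP; rewrite /= eqEsubset subsetT -(gen_tperm z) gen_subG.
by apply/subsetP => _ /imsetP[y _ ->]; rewrite tpermC.
Qed.

Section GenProd.
Variables (n : nat) (H : {group 'S_n * 'S_n}).
Hypothesis n5 : 5 <= n.

Lemma Alt_sub_normal (A : {group 'S_n}) a : [set: 'S_n] \subset 'N(A) ->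
  a \in A -> ~~ odd_perm a -> a != 1 -> 'Alt_('I_n) \subset A.
Proof.
move=> nA aA ae a1.
have /simpleP[_] : simple 'Alt_('I_n) by apply: simple_Alt5; rewrite card_ord.
move/(_ (A :&: 'Alt_('I_n))%G); case.
- rewrite /normal subsetIr /= normsI ?normG //.
  by apply: subset_trans nA; apply: subsetT.
- move/setP/(_ a); rewrite !inE aA (negPf a1) => /negbT /negP; case.
  by have := Alt_even a; rewrite ae !inE.
by move<-; apply: subsetIl.
Qed.

Lemma gen_Sn_prod a b c d :
    (forall s, exists t, (s, t) \in H) -> (forall t, exists s, (s, t) \in H) ->
    (a, 1) \in H -> ~~ odd_perm a -> a != 1 ->
    (1, b) \in H -> ~~ odd_perm b -> b != 1 ->
    c \in H -> odd_perm c.1 -> ~~ odd_perm c.2 ->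
    d \in H -> ~~ odd_perm d.1 -> odd_perm d.2 ->
  H = [set: 'S_n * 'S_n]%G.
Proof.
move=> p1 p2 aH ae a1 bH be b1 cH c1 c2 dH d1 d2.
(* The trace of [H] on the first factor is normalised by all of S_n: conjugating [(x, 1)] by some
   [(s, t)] in [H] affects only the first component. *)
have s1 : 'Alt_('I_n) \subset pairg1 _ @*^-1 H.
  apply: (@Alt_sub_normal _ a) => //; last by rewrite !inE.
  apply/subsetP => s _; rewrite inE; apply/subsetP => _ /imsetP[x xA ->].
  move: xA; rewrite !inE => xH; have [t stH] := p1 s.
  have e : (x ^ s, 1) = (x, 1) ^ (s, t) by rewrite -{1}(conj1g t).
  by change ((x ^ s, 1) \in H); rewrite e groupJ.
have s2 : 'Alt_('I_n) \subset @pair1g _ _ @*^-1 H.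
  apply: (@Alt_sub_normal _ b) => //; last by rewrite !inE.
  apply/subsetP => s _; rewrite inE; apply/subsetP => _ /imsetP[x xA ->].
  move: xA; rewrite !inE => xH; have [t stH] := p2 s.
  have e : (1, x ^ s) = (1, x) ^ (t, s) by rewrite -{1}(conj1g t).
  by change ((1, x ^ s) \in H); rewrite e groupJ.
have even u : ~~ odd_perm u.1 -> ~~ odd_perm u.2 -> u \in H.
  case: u => x y /= xe ye.
  have /(subsetP s1) : x \in 'Alt_('I_n) by rewrite Alt_even.
  have /(subsetP s2) : y \in 'Alt_('I_n) by rewrite Alt_even.
  rewrite !inE => h2 h1.
  have -> : (x, y) = (x, 1) * (1, y) by congr (_, _); rewrite ?mulg1 ?mul1g.
  exact: groupM.
(* [c] has parities (odd, even) and [d] has (even, odd); multiplying by them reduces every pair to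
   A_n x A_n. *)
have evenc u : ~~ odd_perm u.2 -> u \in H.
  case e: (odd_perm u.1) => ue; last by apply: even; rewrite ?e.
  by rewrite -(groupMr _ cH); apply: even; rewrite odd_permM ?e ?c1 ?(negPf ue) ?(negPf c2).
apply/val_inj/setP => u; rewrite !inE.
case e: (odd_perm u.2); last by apply: evenc; rewrite e.
by rewrite -(groupMr _ dH); apply: evenc; rewrite odd_permM e d2.
Qed.

End GenProd.

Lemma expg_invol (gT : finGroupType) (s : gT) i :
  s * s = 1 -> s ^+ i = if odd i then s else 1.
Proof.
move=> ss; elim: i => // i IH; rewrite expgS IH /=.
by case: (odd i); rewrite ?ss ?mulg1.
Qed.

Lemma Sigma_pair (gT : finGroupType) (G : {group gT * gT}) (x1 x2 y1 y2 : gT)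
    (w : gT * gT) : w \in Sigma G (x1, x2) (y1, y2) ->
  exists i g1 g2, [\/ w = ((x1 ^+ i) ^ g1, (x2 ^+ i) ^ g2),
    w = ((y1 ^+ i) ^ g1, (y2 ^+ i) ^ g2)
    | w = (((x1 * y1) ^+ i) ^ g1, ((x2 * y2) ^+ i) ^ g2)].
Proof.
have E (a b g1 g2 : gT) i : ((a, b) ^+ i) ^ (g1, g2) = ((a ^+ i) ^ g1, (b ^+ i) ^ g2).
  by rewrite [(a, b) ^+ i]surjective_pairing fst_expg snd_expg.
case/Sigma_conj => i [[g1 g2] h]; exists i, g1, g2; rewrite -!E.
exact: h.
Qed.

(** * The involution of the second structure *)

Lemma flip_fix n k (kn : k <= n) (x : 'I_n) : k <= x.+1 -> flip kn x = x.
Proof. by move=> kx; apply: val_inj; rewrite /= flipE ltnNge kx. Qed.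

(** Two cases by the parity of [n], since [k] must be odd. In both, conjugating [(p q)] by [b]
    produces a transposition joining [k - 1] to the last point [n - 1]; the cycle then spreads it
    over all points below [k]. *)
Lemma exists_involution_completing n : 5 <= n -> exists k (kn : k <= n) (p q : 'I_n) (b : 'S_n),
  [/\ odd k, 3 <= k, k.+2 <= n, p = k :> nat & q = k.+1 :> nat] /\
  [/\ b * b = 1, odd_perm b = false, moved b = 4, b ^ flip kn = b
    & forall H : {group 'S_n}, cyc kn \in H -> tperm p q \in H -> b \in H ->
      H = [set: 'S_n]%G].
Proof.
move=> n5.
suff [k [kn [p [q [x [y [z [t [? [u fb gen]]]]]]]]]] :
  exists k (kn : k <= n) (p q x y z t : 'I_n),
  [/\ odd k, 3 <= k, k.+2 <= n, p = k :> nat & q = k.+1 :> nat] /\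
  [/\ uniq [:: x; y; z; t],
      (tperm x y * tperm z t) ^ flip kn = tperm x y * tperm z t
    & forall H : {group 'S_n}, cyc kn \in H -> tperm p q \in H ->
      tperm x y * tperm z t \in H -> H = [set: 'S_n]%G].
  exists k, kn, p, q, (tperm x y * tperm z t); split=> //; split=> //.
  - move: u; rewrite /= !inE !negb_or => /and4P[/and3P[xy xz xt] /andP[yz yt] zt _].
    have cm : commute (tperm x y) (tperm z t).
      by apply/commgP/conjg_fixP; rewrite tpermJ !tpermD // eq_sym.
    by rewrite mulgA -[_ * _ * tperm x y]mulgA -cm mulgA tperm2 mul1g tperm2.
  - by rewrite odd_permM !odd_tperm; move: u; rewrite /= !inE; do ?case: eqP.
  - exact: moved_tperm2.
case on: (odd n).
- have [kn l0 l1] : [/\ n - 2 <= n, 0 < n & n - 4 < n] by split; lia.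
  have [l2 l3 l4] : [/\ n - 3 < n, n - 2 < n & n - 1 < n] by split; lia.
  pose a := Ordinal l0; pose d := Ordinal l1; pose c := Ordinal l2.
  pose p := Ordinal l3; pose q := Ordinal l4.
  (* Odd [n]: [b] is [(k-1 k)(0 k-2)]. The reflection swaps 0 and [k - 2] and fixes [k - 1] and
     [k]. *)
  exists (n - 2), kn, p, q, c, p, a, d; split; first by split=> /=; lia.
  have u : uniq [:: c; p; a; d] by rewrite /= !inE -!val_eqE /=; lia.
  split=> //.
    have fd : flip kn d = a by apply: val_inj; rewrite /= flipE /=; case: ifP; lia.
    have fa : flip kn a = d by apply: val_inj; rewrite /= flipE /=; case: ifP; lia.
    have fc : flip kn c = c by apply: flip_fix => /=; lia.
    have fp : flip kn p = p by apply: flip_fix => /=; lia.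
    by rewrite conjMg !tpermJ fd fa fc fp (tpermC d).
  move=> H cH tH bH; apply: (@gen_Sn _ _ q) => y.
  case: (ltnP y (n - 2)) => yk.
    apply: (@mem_tperm_cyc _ _ kn _ c) => //=; try lia.
    suff -> : tperm c q = tperm p q ^ (tperm c p * tperm a d) by rewrite groupJ.
    by rewrite conjgM !tpermJ tpermR !tpermD // -val_eqE /=; lia.
  have [->|yq] := eqVneq y q; first by rewrite tperm1 group1.
  suff -> : y = p by [].
  apply: val_inj => /=; move: yq; rewrite -val_eqE /=; have := ltn_ord y; lia.
have [kn l0 l2] : [/\ n - 3 <= n, 0 < n & n - 4 < n] by split; lia.
have [l3 l4 l5] : [/\ n - 3 < n, n - 2 < n & n - 1 < n] by split; lia.
pose a := Ordinal l0; pose c := Ordinal l2.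
pose p := Ordinal l3; pose q := Ordinal l4; pose r := Ordinal l5.
(* Even [n]: [b] is [(k-1 k)(k+1 k+2)], and the reflection fixes all four points. *)
exists (n - 3), kn, p, q, c, p, q, r; split; first by split=> /=; lia.
have u : uniq [:: c; p; q; r] by rewrite /= !inE -!val_eqE /=; lia.
split=> //.
  have fc : flip kn c = c by apply: flip_fix => /=; lia.
  have fp : flip kn p = p by apply: flip_fix => /=; lia.
  have fq : flip kn q = q by apply: flip_fix => /=; lia.
  have fr : flip kn r = r by apply: flip_fix => /=; lia.
  by rewrite conjMg !tpermJ fc fp fq fr.
move=> H cH tH bH; apply: (@gen_Sn _ _ r) => y.
have low (x : 'I_n) : x < n - 3 -> tperm x r \in H.
  move=> xk; apply: (@mem_tperm_cyc _ _ kn _ c) => //=; try lia.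
  suff -> : tperm c r = tperm p q ^ (tperm c p * tperm q r) by rewrite groupJ.
  rewrite conjgM !tpermJ tpermR (tpermD (x := c)) -?val_eqE /=; try lia.
  by rewrite tpermL tpermD // -val_eqE /=; lia.
(* The points [q] and [p] remain. As 0 differs from [k - 1], [b] fixes [a] and swaps [q] and [r], so
   [(a r)] gives [(a q)], then [(q r)], then [(p r)]. *)
have arH : tperm a r \in H by apply: low => /=; lia.
have aqH : tperm a q \in H.
  suff -> : tperm a q = tperm a r ^ (tperm c p * tperm q r) by rewrite groupJ.
  rewrite conjgM !tpermJ !(tpermD (x := c)) -?val_eqE /=; try lia.
  by rewrite tpermR tpermD // -val_eqE /=; lia.
have qrH : tperm q r \in H.
  suff -> : tperm q r = tperm a q ^ tperm a r by rewrite groupJ.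
  by rewrite tpermJ tpermL tpermD 1?tpermC // -val_eqE /=; lia.
have prH : tperm p r \in H.
  suff -> : tperm p r = tperm q r ^ tperm p q by rewrite groupJ.
  by rewrite tpermJ tpermR tpermD // -val_eqE /=; lia.
case: (ltnP y (n - 3)) => yk; first exact: low.
have [->|yr] := eqVneq y r; first by rewrite tperm1 group1.
have [->//|yq] := eqVneq y q.
suff -> : y = p by [].
apply: val_inj => /=; move: yr yq; rewrite -!val_eqE /=; have := ltn_ord y; lia.
Qed.

Lemma tperm_last_neq n (u v : 'I_n) :
  1 < n -> u = n - 2 :> nat -> v = n - 1 :> nat -> u != v.
Proof. by move=> n2 eu ev; rewrite -val_eqE /= eu ev; lia. Qed.

(** * Product, parities and generation for tau, sigma, rho *)

Section Triple.
Variables (n : nat) (kn : n.-1 <= n) (u v : 'I_n).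
Hypotheses (n5 : 5 <= n) (eu : u = n - 2 :> nat) (ev : v = n - 1 :> nat).

Lemma tperm_mul_cyc : tperm u v * cyc (leqnn n) = cyc kn.
Proof.
(* Products act from left to right: [n - 2] goes to [n - 1] and then to 0, while [n - 1] goes to
   [n - 2] and back. *)
apply/permP => x; apply: val_inj; rewrite /= permM !cycE.
case: tpermP => [->|->|] /=; [by rewrite ?eu ?ev; do ?case: ifP => ?; lia..|].
do 2![move/eqP; rewrite -val_eqE /= => ?]; have := ltn_ord x.
by do ?case: ifP => ?; lia.
Qed.

(** The two cycles differ by a transposition, so their parities are opposite, and the one of odd
    length is even. *)
Lemma odd_cycn : odd_perm (cyc (leqnn n)) = ~~ odd n.
Proof.
have tS : odd_perm (cyc kn) = ~~ odd_perm (cyc (leqnn n)).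
  by rewrite -tperm_mul_cyc odd_permM odd_tperm (tperm_last_neq _ eu ev); lia.
case on: (odd n); first exact: cyc_even.
by move: tS; rewrite cyc_even; [case: odd_perm | lia].
Qed.

Lemma odd_cyc_pred : odd_perm (cyc kn) = odd n.
Proof.
by rewrite -tperm_mul_cyc odd_permM odd_cycn odd_tperm (tperm_last_neq _ eu ev); [case: odd | lia].
Qed.

Lemma gen_tperm_cyc_pred (H : {group 'S_n}) :
  tperm u v \in H -> cyc kn \in H -> H = [set: 'S_n]%G.
Proof.
move=> tH rH; apply: (@gen_Sn _ _ v) => y.
case: (ltnP y n.-1) => yk.
  by apply: (@mem_tperm_cyc _ _ kn _ u) => //=; lia.
suff -> : y = v by rewrite tperm1 group1.
by apply: val_inj => /=; have := ltn_ord y; lia.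
Qed.

End Triple.

(** * Both pairs generate S_n x S_n *)

Lemma gen_pair_proj n (x1 x2 y1 y2 : 'S_n) :
    <<[set x1; y1]>> = [set: 'S_n] -> <<[set x2; y2]>> = [set: 'S_n] ->
  let H := <<[set (x1, x2); (y1, y2)]>> in
  (forall s, exists t, (s, t) \in H) /\ (forall t, exists s, (s, t) \in H).
Proof.
move=> g1 g2 H; split=> s.
  have : s \in fst @* H by rewrite morphim_gen ?subsetT // morphimU !morphim_set1 ?inE //= g1 inE.
  by case/morphimP => -[a t] _ h -> /=; exists t.
have : s \in snd @* H by rewrite morphim_gen ?subsetT // morphimU !morphim_set1 ?inE //= g2 inE.
by case/morphimP => -[t a] _ h -> /=; exists t.
Qed.

Lemma gen_set2 n (x y : 'S_n) :
  (forall H : {group 'S_n}, x \in H -> y \in H -> H = [set: 'S_n]%G) ->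
  <<[set x; y]>> = [set: 'S_n].
Proof.
move=> h; apply: (congr1 (@gval _) (h <<[set x; y]>>%G _ _)).
  by rewrite mem_gen // !inE eqxx.
by rewrite mem_gen // !inE eqxx orbT.
Qed.

Lemma invol_inv (gT : finGroupType) (s : gT) : s * s = 1 -> s^-1 = s.
Proof. by move=> ss; apply/eqP; rewrite eq_invg_mul ss. Qed.

Lemma first_pair_generates n (kn : n.-1 <= n) (u v : 'I_n) :
    5 <= n -> u = n - 2 :> nat -> v = n - 1 :> nat ->
  let sigma := cyc (leqnn n) in
  <<[set (tperm u v, sigma); (sigma, (cyc kn)^-1)]>> = [set: 'S_n * 'S_n].
Proof.
move=> n5 eu ev sigma; set tau := tperm u v; set rho := cyc kn.
have ts : tau * sigma = rho by apply: tperm_mul_cyc.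
set x := (tau, sigma); set y := (sigma, rho^-1).
have [p1 p2] : (forall s, exists t, (s, t) \in <<[set x; y]>>) /\
    (forall t, exists s, (s, t) \in <<[set x; y]>>).
  apply: gen_pair_proj; apply: gen_set2 => H.
    move=> tH sH; apply: (@gen_tperm_cyc_pred _ kn _ _ n5 eu ev) => //.
    by rewrite -/rho -ts groupM.
  rewrite groupV => sH rH; apply: (@gen_tperm_cyc_pred _ kn _ _ n5 eu ev) => //.
  by rewrite -/tau -(mulgK sigma tau) ts groupM ?groupV.
have xH : x \in <<[set x; y]>>%G by rewrite mem_gen // !inE eqxx.
have yH : y \in <<[set x; y]>>%G by rewrite mem_gen // !inE eqxx orbT.
have sq1 k (knn : k <= n) : 2 < k -> cyc knn ^+ 2 != 1.
  move=> k3; apply/eqP => e; have := moved_cycX knn 2.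
  rewrite e /moved; have /= := moved_cycX knn 0; rewrite expg0 /moved dvdn0 => ->.
  by case: ifP => [/dvdn_leq|]; lia.
have sqe (s : 'S_n) : ~~ odd_perm (s ^+ 2) by rewrite odd_permX.
have ot : odd_perm tau by rewrite odd_tperm (tperm_last_neq (ltnW (ltnW (ltnW n5))) eu ev).
have os : odd_perm sigma = ~~ odd n := odd_cycn kn n5 eu ev.
have orh : odd_perm rho = odd n := odd_cyc_pred kn n5 eu ev.
have aH : (sigma ^+ 2, 1) \in <<[set x; y]>>%G.
  (* 2 (n - 1)^2 is 0 modulo the order of rho and 2 modulo that of sigma. *)
  have -> : (sigma ^+ 2, 1) = y ^+ (n.-1 * 2 * n.-1).
    rewrite [RHS]surjective_pairing fst_expg snd_expg /= expgVn.
    rewrite [in (rho ^+ _)^-1]mulnC (expgM rho) cycXk expg1n invg1; congr (_, _).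
    have -> : (n.-1 * 2 * n.-1 = n * (n.-2 * 2) + 2)%N by clear -n5; case: n n5 => [|[|m]] // _ /=; nia.
    by rewrite expgD expgM cycXk expg1n mul1g.
  exact: groupX.
have bH : (1, sigma ^+ 2) \in <<[set x; y]>>%G.
  have -> : (1, sigma ^+ 2) = x ^+ 2.
    by rewrite [RHS]surjective_pairing fst_expg snd_expg /= [tau ^+ 2]tperm2.
  exact: groupX.
suff [c [d [[cH c1 c2] [dH d1 d2]]]] : exists c d, [/\ c \in <<[set x; y]>>%G,
    odd_perm c.1 & ~~ odd_perm c.2] /\
    [/\ d \in <<[set x; y]>>%G, ~~ odd_perm d.1 & odd_perm d.2].
  by have /(congr1 (@gval _)) := @gen_Sn_prod n <<[set x; y]>>%G n5 (sigma ^+ 2) (sigma ^+ 2) c d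
    p1 p2 aH (sqe _) (sq1 _ _ (ltnW (ltnW n5))) bH (sqe _) (sq1 _ _ (ltnW (ltnW n5)))
    cH c1 c2 dH d1 d2.
(* The parities of [y] are (even, odd) for odd [n] and (odd, even) for even [n]. The complementary
   element is [x] in the first case and [x * y], that is (rho, tau), in the second. *)
case on: (odd n).
  by exists x, y; rewrite /x /y /= odd_permV os orh ot on.
exists y, (x * y); rewrite groupM //= odd_permV !odd_permM odd_permV os orh ot on.
by rewrite yH.
Qed.

(** As [y] is an involution, squaring each generator kills one component, and the generators
    themselves have the two mixed parities. *)
Lemma second_pair_generates n (x y : 'S_n) :
    5 <= n -> <<[set x; y]>> = [set: 'S_n] -> odd_perm x -> ~~ odd_perm y ->
    y * y = 1 -> x ^+ 2 != 1 ->
  <<[set (x, y); (y, x)]>> = [set: 'S_n * 'S_n].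
Proof.
move=> n5 gxy xo ye yy x2.
have gyx : <<[set y; x]>> = [set: 'S_n] by rewrite setUC.
have [p1 p2] := gen_pair_proj gxy gyx.
set a := (x, y); set b := (y, x).
have aH : a \in <<[set a; b]>>%G by rewrite mem_gen // !inE eqxx.
have bH : b \in <<[set a; b]>>%G by rewrite mem_gen // !inE eqxx orbT.
have a2 : (x ^+ 2, 1) \in <<[set a; b]>>%G by rewrite -yy; exact: (groupX 2 aH).
have b2 : (1, x ^+ 2) \in <<[set a; b]>>%G by rewrite -yy; exact: (groupX 2 bH).
have xe : ~~ odd_perm (x ^+ 2) by rewrite odd_permX.
by have /(congr1 (@gval _)) := gen_Sn_prod n5 p1 p2 a2 xe x2 b2 xe x2 aH xo ye bH ye xo.
Qed.

(** * Disjointness of the two [Sigma] sets *)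

Lemma mulg_conj (gT : finGroupType) (x y : gT) : x * y = (y * x) ^ y.
Proof. by rewrite conjgE -mulgA mulKg. Qed.

(* The hypothesis on [odd_perm sigma] is for n = 5 only, where b and rho ^+ 2 are
   conjugate; parity then separates the other components. *)
Lemma Sigma_disjoint n k (kn : k <= n) (kn1 : n.-1 <= n) (u v p q : 'I_n) (b : 'S_n)
    (G : {group 'S_n * 'S_n}) (sigma := cyc (leqnn n)) (rho := cyc kn1)
    (alpha := cyc kn * tperm p q) :
    5 <= n -> 3 <= k -> k.+2 <= n -> u != v -> tperm u v * sigma = rho ->
    commute (cyc kn) (tperm p q) -> odd_perm alpha ->
    b * b = 1 -> moved b = 4 ->
    (n = 5 -> odd_perm sigma = false) ->
  Sigma G (tperm u v, sigma) (sigma, rho^-1) :&: Sigma G (alpha, b) (b, alpha)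
    \subset [set 1].
Proof.
move=> n5 k3 kn2 uv ts cT ao bb mb os; apply/subsetP => w /setIP[].
have mtau i : moved (tperm u v ^+ i) = if odd i then 2 else 0.
  rewrite expg_invol ?tperm2 //; case: ifP => _; first exact: moved_tperm.
  exact: moved1.
have ma j : odd j = false -> moved (alpha ^+ j) = 0 \/ moved (alpha ^+ j) = k.
  move=> je; rewrite expgMn // (expg_invol j (tperm2 p q)) je mulg1 moved_cycX.
  by case: ifP; [left | right].
have msg i : moved (sigma ^+ i) = 0 \/ moved (sigma ^+ i) = n.
  by rewrite moved_cycX; case: ifP; [left | right].
have mrh i : moved (rho ^+ i) = 0 \/ moved (rho ^+ i) = n.-1.
  by rewrite moved_cycX; case: ifP; [left | right].
(* For [n = 5], rho is a 4-cycle, so a power of it squaring to 1 has even exponent. *)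
have rho2 i (g : 'S_n) : n = 5 -> (rho ^+ i) ^ g * (rho ^+ i) ^ g = 1 -> ~~ odd i.
  move=> e; rewrite -conjMg -expgD addnn => /(congr1 (@moved _)); rewrite movedJ.
  rewrite moved1 moved_cycX; case: ifP => [|_]; last by lia.
  by rewrite e => /dvdnP[c]; lia.
pose m1 := moved w.1; pose m2 := moved w.2.
have fin : m1 = 0 -> m2 = 0 -> w \in [set 1].
  by move=> /moved_eq0 e1 /moved_eq0 e2; rewrite inE [w]surjective_pairing e1 e2.
have ts' : sigma * rho^-1 = tperm u v by rewrite -ts invMg mulKVg tpermV.
move=> /Sigma_pair S1 /Sigma_pair S2.
(* The cases are powers of [x1], [y1] and [x1 y1], with the parity data that [n = 5] requires. *)
have F1 : [\/ (m1 = 0 \/ m1 = 2) /\ (m2 = 0 \/ m2 = n),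
    [/\ m1 = 0 \/ m1 = n, m2 = 0 \/ m2 = n.-1
       & n = 5 -> w.2 * w.2 = 1 -> odd_perm w.1 = false]
  | [/\ m1 = 0 \/ m1 = n.-1, m2 = 0 \/ m2 = 2
       & n = 5 -> w.1 * w.1 = 1 -> odd_perm w.2 = false]].
  rewrite /m1 /m2; case: S1 => i [g1 [g2 [->|->|->]]] /=; rewrite ?expgVn !movedJ.
  - by constructor 1; rewrite mtau; split=> //; case: odd; [right | left].
  - constructor 2; rewrite movedV; split=> // n5' e.
    by rewrite odd_permJ odd_permX os // andbF.
  - constructor 3; rewrite ts ts' mtau; split=> // [|n5' e].
      by case: odd; [right | left].
    by rewrite odd_permJ odd_permX (negPf (rho2 i g1 n5' e)).
(* Powers of [x2] and [y2] are split by the parity of the exponent: an even one kills [b], an odd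
   one makes the alpha component odd. *)
have F2 : [\/ [/\ m1 = 0 \/ m1 = k & m2 = 0],
     [/\ m2 = 4, w.2 * w.2 = 1 & odd_perm w.1] |
     [\/ [/\ m1 = 0 & m2 = 0 \/ m2 = k], 
     [/\ m1 = 4, w.1 * w.1 = 1 & odd_perm w.2] | m1 = m2]].
  rewrite /m1 /m2; case: S2 => j [g1 [g2 [->|->|->]]] /=.
  - rewrite !movedJ (expg_invol j bb) !odd_permJ odd_permX ao; case oj: (odd j).
      by constructor 2; rewrite mb -conjMg bb conj1g.
    by constructor 1; rewrite moved1; split=> //; apply: ma.
  - rewrite !movedJ (expg_invol j bb) !odd_permJ odd_permX ao; case oj: (odd j).
      by constructor 3; constructor 2; rewrite mb -conjMg bb conj1g.
    by constructor 3; constructor 1; rewrite moved1; split=> //; apply: ma.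
  - constructor 3; constructor 3; rewrite !movedJ.
    rewrite (mulg_conj b alpha).
    by rewrite -conjXg movedJ.
(* Counting leaves only a component moving [4 = n - 1] points; there the other component would be
   both even and odd. *)
case: F1 F2 => [[a1 a2]|[a1 a2 a3]|[a1 a2 a3]];
  case=> [[c1 c2]|[c1 c2 c3]|[[c1 c2]|[c1 c2 c3]|c1]]; try by apply: fin; lia.
- by have := a3 _ c2; rewrite c3 => /(_ ltac:(lia)).
- by have := a3 _ c2; rewrite c3 => /(_ ltac:(lia)).
Qed.

(** * Assembly of the structure and strong reality *)

Theorem lemma19 (n : nat) (hn : 5 <= n) :
  strongly_real_beauville [set: 'S_n * 'S_n]%G.
Proof.
have kn1 : n.-1 <= n by lia.
have [un vn] : n - 2 < n /\ n - 1 < n by lia.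
pose u := Ordinal un; pose v := Ordinal vn.
set tau := tperm u v; pose sigma := cyc (leqnn n); pose rho := cyc kn1.
have [k [kn [p [q [b [[ko k3 kn2 pk qk] [bb be mb fb genb]]]]]]] := exists_involution_completing hn.
pose alpha := cyc kn * tperm p q.
have uv : u != v by apply: tperm_last_neq => //; lia.
have pq : p != q by rewrite -val_eqE /= pk qk; lia.
have ts : tau * sigma = rho by apply: tperm_mul_cyc.
have cfix (x : 'I_n) : k <= x -> cyc kn x = x.
  by move=> kx; apply: val_inj; rewrite /= cycE; do ?case: ifP => ?; lia.
have cT : commute (cyc kn) (tperm p q).
  by apply/commute_sym/commgP/conjg_fixP; rewrite tpermJ !cfix ?pk ?qk.
have ao : odd_perm alpha by rewrite odd_permM cyc_even // odd_tperm pq.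
have aX i : alpha ^+ i = cyc kn ^+ i * (if odd i then tperm p q else 1).
  by rewrite expgMn // (expg_invol i (tperm2 p q)).
have a2 : alpha ^+ 2 != 1.
  apply/eqP => /(congr1 (@moved _)); rewrite aX mulg1 moved1 moved_cycX.
  by case: ifP => [/dvdn_leq|]; lia.
have gab : <<[set alpha; b]>> = [set: 'S_n].
  apply: gen_set2 => H aH bH; apply: genb => //.
    (* As [k] is odd, the power [k + 1] of alpha is the cycle and the power [k] is the
       transposition. *)
    by have := groupX k.+1 aH; rewrite aX /= ko mulg1 expgS cycXk mulg1.
  by have := groupX k aH; rewrite aX ko cycXk mul1g.
exists (tau, sigma), (sigma, rho^-1), (alpha, b), (b, alpha); split.
  split.
  - exact: first_pair_generates.
  - by apply: second_pair_generates => //; rewrite be.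
  apply/eqP; rewrite eqEsubset sub1set inE !Sigma1 ?inE //= andbT.
  apply: Sigma_disjoint => // n5.
  by rewrite (odd_cycn kn1 hn (erefl (val u)) (erefl (val v))) n5.
pose f := flip kn1; pose g := flip kn.
have fu : f u = u by apply: flip_fix => /=; lia.
have fv : f v = v by apply: flip_fix => /=; lia.
have fE x : f * x * f^-1 = x ^ f by rewrite conjgE flipV mulgA.
have gE x : g * x * g^-1 = x ^ g by rewrite conjgE flipV mulgA.
have ft : tau ^ f = tau by rewrite tpermJ fu fv.
have fr : rho ^ f = rho^-1 by apply: flip_cyc.
have es : sigma = tau * rho by rewrite -ts tpermKg.
have ga : alpha ^ g = alpha^-1.
  rewrite conjMg flip_cyc tpermJ !flip_fix ?pk ?qk //; last by lia.
  by rewrite /alpha cT invMg tpermV.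
have gb : b ^ g = b^-1 by rewrite fb invol_inv.
(* The automorphism is trivial. [f] sends sigma = tau rho to tau rho^-1, while sigma^-1 is rho^-1
   tau; conjugating further by tau or by rho^-1 corrects the order, and each commutes with the other
   element to be inverted in its component. *)
exists 1, (tau * f, rho^-1 * f), (g, g).
rewrite group1 !inE !perm1; split=> //.
- have E1 x : tau * f * x * (tau * f)^-1 = tau * x ^ f * tau^-1.
    by rewrite invMg -fE !mulgA.
  have E2 x : rho^-1 * f * x * (rho^-1 * f)^-1 = rho^-1 * x ^ f * rho.
    by rewrite invMg invgK -fE !mulgA.
  have sf : sigma ^ f = tau * rho^-1 by rewrite es conjMg ft fr.
  have si : sigma^-1 = rho^-1 * tau^-1 by rewrite es invMg.
  split; congr (_, _).
  + by apply: etrans (E1 tau) _; rewrite ft mulgK tpermV.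
  + by apply: etrans (E2 sigma) _; rewrite sf si tpermV mulgA mulgKV.
  + by apply: etrans (E1 sigma) _; rewrite sf si tpermKg.
  + by apply: etrans (E2 rho^-1) _; rewrite conjVg fr invgK mulVg mul1g.
- by split; congr (_, _); apply: etrans (gE _) _.
Qed.
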